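(* The logics $\mathsf{CHL}_0$ and $\mathsf{CHL}_1$ prove exactly the same formulas as $\mathsf{CHL}$.
   Context: Labels: $\bot,\top$ and propositional variables (arity 0), $\neg,\Box$ (arity 1), $\wedge,\vee,\to$ (arity 2). A graph is $\langle V,r,S,\lambda\rangle$ with $V$ finite, root $r$, labelling $\lambda$, $S:V\to V^{*}$ ordered successors (length = arity of label); every vertex reachable from $r$. A (cyclic) formula is a graph in which every cycle (closed path of pairwise distinct vertices along successors) contains a $\Box$-labelled vertex. Bisimulation: $aRa'$ implies equal labels and $i$-th successors related; $\simeq$ = bisimilarity relating roots. $\phi$ modalised in $p$: every root-to-$p$ path passes a $\Box$-labelled vertex; then $\digamma p.\phi$ identifies the root with all $p$-labelled vertices (keeping the root's label). $\Box^\bullet\phi:=\digamma p.\Box(\phi\wedge p)$ ($p$ not in $\phi$). $\mathsf K^{\circ-}$: least set of cyclic formulas containing all substitution instances of propositional tautologies, all $\Box(\phi\to\psi)\to(\Box\phi\to\Box\psi)$, all $\phi\leftrightarrow\psi$ with $\phi\simeq\psi$, and closed under modus ponens and necessitation. $\mathsf{CHL}$ is $\mathsf K^{\circ-}$ closed additionally under Löb's rule (from $\vdash\Box\phi\to\phi$ infer $\vdash\phi$). $\mathsf K^{\circ}$ is $\mathsf K^{\circ-}$ closed additionally under IPE: if $\phi,\psi$ are modalised in $p$ and $\vdash\phi\leftrightarrow\psi$ then $\vdash\digamma p.\phi\leftrightarrow\digamma p.\psi$. $\mathsf{CHL}_0$ is $\mathsf K^\circ$ plus the axiom $\digamma p.\Box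 p$ (closed under the rules). $\mathsf{CHL}_1$ is $\mathsf K^{\circ-}$ closed additionally under the rule: from $\vdash\phi$ infer $\vdash\Box^\bullet\phi$. *)

(* Defs.v *)
From HB Require Import structures.
From mathcomp Require Import all_boot.

Set Implicit Arguments.
Unset Strict Implicit.
Unset Printing Implicit Defensive.

Inductive label := LBot | LTop | LVar of nat | LNeg | LBox | LAnd | LOr | LImp.

Lemma label_comparable : comparable label.
Proof. by rewrite /comparable /decidable; do 2 decide equality. Defined.
HB.instance Definition _ := hasDecEq.Build label (compareP label_comparable).

Definition arity (l : label) : nat :=
  match l with
  | LBot | LTop | LVar _ => 0
  | LNeg | LBox => 1
  | LAnd | LOr | LImp => 2
  end.

Record graph := Graph {
  vertex :> finType;
  root : vertex;
  succ : vertex -> seq vertex;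
  lab : vertex -> label;
  size_succ : forall v, size (succ v) = arity (lab v);
  reachable : forall v, connect (fun x y => y \in succ x) root v
}.

Definition edge (G : graph) : rel G := fun x y => y \in succ x.

Definition is_box (G : graph) (v : G) : bool := lab v == LBox.

(* [ucycle] also accepts the empty sequence, which is not a cycle here. *)
Definition cycles_boxed (G : graph) : Prop :=
  forall c : seq G, c != [::] -> ucycle (@edge G) c -> has (@is_box G) c.

Record formula := Formula {
  fgraph :> graph;
  boxed : cycles_boxed fgraph
}.

Definition bisimulation (G H : graph) (R : G -> H -> Prop) : Prop :=
  forall (a : G) (b : H), R a b ->
    lab a = lab b /\
    forall i, i < arity (lab a) -> R (nth a (succ a) i) (nth b (succ b) i).

Definition bisimilar (G H : graph) : Prop :=
  exists2 R : G -> H -> Prop, bisimulation R & R (root G) (root H).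

Definition modalised (p : nat) (G : graph) : Prop :=
  forall s : seq G, path (@edge G) (root G) s ->
    lab (last (root G) s) = LVar p -> has (@is_box G) (root G :: s).

Definition occurs (p : nat) (G : graph) : Prop := exists v : G, lab v = LVar p.

(* Graphs with a fresh root: [None] is the new vertex. *)

Section Leaf.
Variables (l : label) (hl : arity l = 0).

Lemma leaf_size (v : unit) : size ([::] : seq unit) = arity l.
Proof. by rewrite hl. Qed.

Lemma leaf_reach (v : unit) :
  connect (fun x y : unit => y \in ([::] : seq unit)) tt v.
Proof. by case: v; apply: connect0. Qed.

Definition leaf_graph : graph :=
  @Graph unit tt (fun=> [::]) (fun=> l) leaf_size leaf_reach.

Lemma leaf_boxed : cycles_boxed leaf_graph.
Proof. by case=> [|x [|y s]] // _ /andP[]. Qed.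

Definition leaf : formula := Formula leaf_boxed.

End Leaf.

Section Unary.
Variables (l : label) (hl : arity l = 1) (G : graph).

Definition unary_succ (v : option G) : seq (option G) :=
  if v is Some x then map Some (succ x) else [:: Some (root G)].

Definition unary_lab (v : option G) : label := if v is Some x then lab x else l.

Lemma unary_size v : size (unary_succ v) = arity (unary_lab v).
Proof. by case: v => [x|] /=; rewrite ?size_map ?size_succ ?hl. Qed.

Lemma unary_reach v : connect (fun x y => y \in unary_succ x) None v.
Proof.
case: v => [x|]; last exact: connect0.
apply: (@connect_trans _ _ (Some (root G))).
  by apply: connect1; rewrite inE.
have /connectP[s ps ->] := reachable x.
apply/connectP; exists (map Some s); last by rewrite last_map.
elim: s (root G) ps => //= y s IH r /andP[ry /IH ->].
by rewrite andbT (mem_map (@Some_inj _)).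
Qed.

Definition unary_graph : graph := Graph unary_size unary_reach.

End Unary.

Section Binary.
Variables (l : label) (hl : arity l = 2) (G H : graph).

Definition binary_succ (v : option (G + H)) : seq (option (G + H)) :=
  match v with
  | Some (inl x) => [seq Some (inl y) | y <- succ x]
  | Some (inr x) => [seq Some (inr y) | y <- succ x]
  | None => [:: Some (inl (root G)); Some (inr (root H))]
  end.

Definition binary_lab (v : option (G + H)) : label :=
  match v with
  | Some (inl x) => lab x
  | Some (inr x) => lab x
  | None => l
  end.

Lemma binary_size v : size (binary_succ v) = arity (binary_lab v).
Proof. by case: v => [[x|x]|] /=; rewrite ?size_map ?size_succ ?hl. Qed.

Lemma binary_reach v : connect (fun x y => y \in binary_succ x) None v.
Proof.
case: v => [[x|x]|]; last exact: connect0.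
- apply: (@connect_trans _ _ (Some (inl (root G)))).
    by apply: connect1; rewrite !inE eqxx.
  have /connectP[s ps ->] := reachable x.
  apply/connectP; exists [seq Some (inl y) | y <- s]; last by rewrite last_map.
  elim: s (root G) ps => //= y s IH r /andP[ry /IH ->].
  by rewrite andbT map_f.
- apply: (@connect_trans _ _ (Some (inr (root H)))).
    by apply: connect1; rewrite !inE eqxx orbT.
  have /connectP[s ps ->] := reachable x.
  apply/connectP; exists [seq Some (inr y) | y <- s]; last by rewrite last_map.
  elim: s (root H) ps => //= y s IH r /andP[ry /IH ->].
  by rewrite andbT map_f.
Qed.

Definition binary_graph : graph := Graph binary_size binary_reach.

End Binary.

(* A cycle meeting the image of a successor-closed embedding comes from a cycle
   of the embedded graph. *)
Lemma embed_cycle (G K : graph) (f : G -> K) (x : G) (s : seq K) :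
    injective f -> (forall y, succ (f y) = map f (succ y)) ->
    (forall y, lab (f y) = lab y) -> cycles_boxed G ->
  ucycle (@edge K) (f x :: s) -> has (@is_box K) (f x :: s).
Proof.
move=> fI fS fL hG /andP[/= cyc un].
have lift u z : path (@edge K) (f z) u ->
    exists2 t, u = map f t & path (@edge G) z t.
  elim: u z => [|y u IH] z /=; first by exists [::].
  case/andP; rewrite {1}/edge fS => /mapP[w wz ->] /IH[t -> pt].
  by exists (w :: t) => //=; rewrite pt andbT.
have {lift} [t] := lift _ _ cyc.
case/lastP: t => [/(congr1 size)|t y]; first by rewrite size_rcons.
rewrite map_rcons => /rcons_inj[es /fI ex]; subst s y => pt.
have := hG (x :: t) isT; rewrite /ucycle /= pt.
rewrite (mem_map fI) (map_inj_uniq fI) in un => /(_ un).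
rewrite /= has_map {1 3}/is_box fL.
by rewrite (@eq_has _ (preim f _) (@is_box G)) // => z; rewrite /= /is_box fL.
Qed.

Lemma cycle_pred (K : graph) (x : K) (c : seq K) :
  cycle (@edge K) c -> x \in c -> exists y, x \in succ y.
Proof. by move=> cc xc; exists (prev c x); exact: prev_cycle cc xc. Qed.

Lemma unary_boxed l hl (G : formula) : cycles_boxed (@unary_graph l hl G).
Proof.
case=> [//|[x|] s] _ cyc.
  by apply: (embed_cycle (f := Some : G -> unary_graph hl G)) cyc => //;
     [exact: Some_inj | exact: boxed].
have /andP[cc _] := cyc.
have [[y|]] := cycle_pred cc (mem_head _ _); last by rewrite inE.
by case/mapP.
Qed.

Lemma binary_boxed l hl (G H : formula) :
  cycles_boxed (@binary_graph l hl G H).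
Proof.
case=> [//|[[x|x]|] s] _ cyc.
- apply: (embed_cycle (f := (fun y => Some (inl y)) : G -> binary_graph hl G H))
    cyc => //; [by move=> ? ? [] | exact: boxed].
- apply: (embed_cycle (f := (fun y => Some (inr y)) : H -> binary_graph hl G H))
    cyc => //; [by move=> ? ? [] | exact: boxed].
- have /andP[cc _] := cyc.
  have [[[y|y]|]] := cycle_pred cc (mem_head _ _); last by rewrite !inE.
    by case/mapP.
  by case/mapP.
Qed.

Definition unary l (hl : arity l = 1) (G : formula) : formula :=
  Formula (@unary_boxed l hl G).

Definition binary l (hl : arity l = 2) (G H : formula) : formula :=
  Formula (@binary_boxed l hl G H).

Definition fBot : formula := @leaf LBot erefl.
Definition fTop : formula := @leaf LTop erefl.
Definition fVar (p : nat) : formula := @leaf (LVar p) erefl.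
Definition fNeg : formula -> formula := @unary LNeg erefl.
Definition fBox : formula -> formula := @unary LBox erefl.
Definition fAnd : formula -> formula -> formula := @binary LAnd erefl.
Definition fOr : formula -> formula -> formula := @binary LOr erefl.
Definition fImp : formula -> formula -> formula := @binary LImp erefl.
Definition fIff (A B : formula) : formula := fAnd (fImp A B) (fImp B A).

(* The quotient identifying the root with all [p]-labelled vertices is carried
   by the vertices not labelled [p]: since the merged vertex keeps the label and
   successors of the root, every edge into a [p]-vertex becomes an edge into the
   root. When [G] is modalised in [p], its root is not labelled [p]. *)
Section Digamma.
Variables (p : nat) (G : graph) (hp : modalised p G).

Definition dvertex := {v : G | lab v != LVar p}.

Lemma droot_subproof : lab (root G) != LVar p.
Proof.
apply/eqP => rp; have := @hp [::] isT rp.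
by rewrite /= orbF /is_box rp.
Qed.

Definition droot : dvertex := exist _ (root G) droot_subproof.

Definition redirect (v : G) : dvertex := insubd droot v.

Definition dsucc (v : dvertex) : seq dvertex := map redirect (succ (val v)).

Definition dlab (v : dvertex) : label := lab (val v).

Lemma dsize v : size (dsucc v) = arity (dlab v).
Proof. by rewrite size_map size_succ. Qed.

Lemma redirectK (v : dvertex) : redirect (val v) = v.
Proof. by apply: val_inj; rewrite val_insubd (valP v). Qed.

Lemma dreach v : connect (fun x y => y \in dsucc x) droot v.
Proof.
have /connectP[s ps es] := reachable (val v).
have -> : v = redirect (val v) by rewrite redirectK.
rewrite es; have {es} : lab (last (root G) s) != LVar p by rewrite -es (valP v).
elim/last_ind: s ps => [|s y IH]; first by rewrite (redirectK droot) connect0.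
rewrite rcons_path last_rcons => /andP[ps ys] yp.
have np : lab (last (root G) s) != LVar p.
  apply/eqP => lp; have := size_succ (last (root G) s).
  by rewrite lp => /size0nil e; rewrite e in ys.
apply: connect_trans (IH ps np) _; apply: connect1.
rewrite /dsucc map_f //.
by rewrite val_insubd np.
Qed.

Definition digamma_graph : graph := Graph dsize dreach.

End Digamma.

Section DigammaBoxed.
Variables (p : nat) (G : formula) (hp : modalised p G).
Let D := digamma_graph hp.

Lemma dedgeP (x y : D) : edge x y ->
  edge (val x) (val y) \/
  (y = root D /\ exists2 u, edge (val x) u & lab u = LVar p).
Proof.
case/mapP=> u ux ->; rewrite /redirect /insubd; case: insubP => [w _ wu|].
  by left; rewrite /= wu.
by move=> /negPn/eqP pu; right; split => //; exists u.
Qed.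

Lemma dpath (x : D) (s : seq D) : root D \notin s ->
  path (@edge D) x s -> path (@edge G) (val x) (map val s).
Proof.
elim: s x => //= y s IH x; rewrite inE negb_or => /andP[ry rs].
case/andP=> /dedgeP[->|[yr _]]; first exact: IH.
by rewrite yr eqxx in ry.
Qed.

Lemma dhas_box (s : seq D) : has (@is_box G) (map val s) = has (@is_box D) s.
Proof. by rewrite has_map; apply: eq_has. Qed.

Lemma digamma_boxed : cycles_boxed D.
Proof.
have real (x : D) s : ucycle (@edge D) (x :: s) -> root D \notin s ->
    edge (val (last x s)) (val x) -> has (@is_box D) (x :: s).
  move=> /andP[/=]; rewrite rcons_path => /andP[ps _] un rs lx.
  rewrite -dhas_box; apply: (@boxed G (map val (x :: s))) => //; rewrite /ucycle.
  rewrite (map_inj_uniq val_inj) [uniq _]un andbT /= rcons_path last_map.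
  by rewrite dpath.
move=> c c0 cyc; have [rc|rc] := boolP (root D \in c).
  have [i s ec] := rot_to rc.
  rewrite -(has_rot i) ec; move: cyc.
  rewrite -(rot_ucycle i) ec => {c c0 rc i ec} cyc.
  have /andP[cc /= /andP[rs _]] := cyc.
  move: cc; rewrite /= rcons_path => /andP[ps /dedgeP[e|[_ [u eu lu]]]].
    exact: real.
  have := @hp (rcons (map val s) u).
  rewrite rcons_path last_rcons (last_map val s (root D)) eu andbT.
  move=> /(_ (dpath rs ps) lu).
  rewrite -rcons_cons has_rcons {1}/is_box lu /=.
  by rewrite dhas_box.
case: c c0 cyc rc => // x s _ cyc; rewrite inE negb_or => /andP[rx rs].
apply: real => //; case/andP: cyc => /=.
rewrite rcons_path => /andP[_ /dedgeP[//|[xr _]]].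
by rewrite xr eqxx in rx.
Qed.

Definition digamma : formula := Formula digamma_boxed.

End DigammaBoxed.

Lemma modalised_box (p : nat) (A : formula) : modalised p (fBox A).
Proof. by []. Qed.

(* To be used with [p] not occurring in [A]; see [bullet]. *)
Definition fBoxBullet (p : nat) (A : formula) : formula :=
  digamma (@modalised_box p (fAnd A (fVar p))).

Inductive pform :=
  | PBot | PTop | PVar of nat | PNeg of pform
  | PAnd of pform & pform | POr of pform & pform | PImp of pform & pform.

Fixpoint peval (e : nat -> bool) (t : pform) : bool :=
  match t with
  | PBot => false
  | PTop => true
  | PVar i => e i
  | PNeg t => ~~ peval e t
  | PAnd t u => peval e t && peval e u
  | POr t u => peval e t || peval e u
  | PImp t u => peval e t ==> peval e u
  end.

Definition tautology (t : pform) : Prop := forall e, peval e t.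

(* Each occurrence of a variable gets its own copy of the substituted graph;
   sharing the copies yields a bisimilar formula. *)
Fixpoint psubst (f : nat -> formula) (t : pform) : formula :=
  match t with
  | PBot => fBot
  | PTop => fTop
  | PVar i => f i
  | PNeg t => fNeg (psubst f t)
  | PAnd t u => fAnd (psubst f t) (psubst f u)
  | POr t u => fOr (psubst f t) (psubst f u)
  | PImp t u => fImp (psubst f t) (psubst f u)
  end.

(* The least set of cyclic formulas containing the axioms of the base logic
   and [Ax], and closed under modus ponens, necessitation and the one-premise
   rules [Ru premise conclusion]. *)
Inductive derivable (Ax : formula -> Prop) (Ru : formula -> formula -> Prop) :
    formula -> Prop :=
  | der_taut (t : pform) (f : nat -> formula) :
      tautology t -> derivable Ax Ru (psubst f t)
  | der_K (A B : formula) :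
      derivable Ax Ru (fImp (fBox (fImp A B)) (fImp (fBox A) (fBox B)))
  | der_bisim (A B : formula) : bisimilar A B -> derivable Ax Ru (fIff A B)
  | der_mp (A B : formula) :
      derivable Ax Ru (fImp A B) -> derivable Ax Ru A -> derivable Ax Ru B
  | der_nec (A : formula) : derivable Ax Ru A -> derivable Ax Ru (fBox A)
  | der_ax (A : formula) : Ax A -> derivable Ax Ru A
  | der_rule (A B : formula) : Ru A B -> derivable Ax Ru A -> derivable Ax Ru B.

Definition no_axiom (A : formula) : Prop := False.

Inductive henkin_axiom : formula -> Prop :=
  | Henkin_axiom (p : nat) :
      henkin_axiom (digamma (@modalised_box p (fVar p))).

Inductive loeb : formula -> formula -> Prop :=
  | Loeb (A : formula) : loeb (fImp (fBox A) A) A.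

Inductive ipe : formula -> formula -> Prop :=
  | IPE (p : nat) (A B : formula)
        (hA : modalised p A) (hB : modalised p B) :
      ipe (fIff A B) (fIff (digamma hA) (digamma hB)).

Inductive bullet : formula -> formula -> Prop :=
  | Bullet (p : nat) (A : formula) :
      ~ occurs p A -> bullet A (fBoxBullet p A).

Definition CHL : formula -> Prop := derivable no_axiom loeb.
Definition CHL0 : formula -> Prop := derivable henkin_axiom ipe.
Definition CHL1 : formula -> Prop := derivable no_axiom bullet.

(* Main.v *)
From mathcomp Require Import all_boot.
Require Import Defs.

(* CHL is contained in CHL1: given a proof of [box A -> A], let [s] be the cyclic
   formula [box ((s -> A) /\ s)]. Then [s -> A] is provable, and the bullet rule
   applied to it yields a solution [t] of [t = box ((s -> A) /\ t)]; guarded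
   equations have one solution up to bisimilarity, so [t] is [s], and [A] follows.

   CHL1 is contained in CHL0: if [A] is provable and [p] does not occur in it,
   then [box (A /\ p) <-> box p] is provable; apply IPE and the Henkin axiom.

   CHL0 is contained in CHL: the Henkin axiom [h] is bisimilar to [box h], and
   IPE is admissible as follows. CHL is closed under substitution, so if
   [A <-> B] is provable, the fixed point [b] of [B] satisfies [A[b/p] <-> b].
   For a vertex [v] of [A] let [W v] be the equivalence of the subformulas at [v]
   of the fixed point [a] of [A] and of [A[b/p]], and let [W] be their
   conjunction. By induction along box-free paths, [box W] implies [W root]
   because [A] is modalised in [p]; as [W root] is equivalent to [a <-> b], a
   second induction gives [box W -> W], and Loeb's rule concludes. *)

Set Implicit Arguments.
Unset Strict Implicit.
Unset Printing Implicit Defensive.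

(** * Ranks as a measure of box-free paths *)

Definition rank (G : graph) (x : G) : nat :=
  #|connect (fun y z => edge y z && ~~ is_box y) x|.

(** Whatever [y] reaches without leaving a box, [x] reaches too; but [y] cannot so reach [x], since
    the edge from [x] to [y] would close a cycle without a box. *)
Lemma rank_lt (G : formula) (x y : G) :
  edge x y -> ~~ is_box x -> rank y < rank x.
Proof.
move=> xy bx; apply: proper_card; apply/properP; split.
  apply/subsetP => z; rewrite -!topredE /=; apply: connect_trans.
  by apply: connect1; rewrite xy.
exists x; first by rewrite -topredE /= connect0.
rewrite -topredE /=; apply/negP => /connectP[s ps ex].
case: (shortenP ps) ex => t pt ut _ ex.
have: has (@is_box G) (y :: t).
  apply: (@boxed G) => //; rewrite /ucycle ut andbT /= rcons_path -ex xy andbT.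
  by apply: sub_path pt => u v /andP[].
(* The restricted edges forbid a box at every vertex of the path except the last one, which is [x]
   and is no box either. *)
apply/negP; move: pt ex bx {ut ps xy}.
elim: t y => [|z t IH] y /=; first by move=> _ -> /negPf->.
by case/andP=> /andP[_ /negPf->] pt ex bx; exact: (IH z).
Qed.

(** Around a cycle without a box the rank would decrease strictly, so by transitivity some vertex
    would have a rank below its own. *)
Lemma boxed_of_rank (G : graph) (r : G -> nat) :
  (forall x y : G, edge x y -> ~~ is_box x -> r y < r x) -> cycles_boxed G.
Proof.
move=> hr [//|x s] _ /andP[cyc _]; apply/negPn/negP; rewrite -all_predC => nb.
have: cycle (fun y z => r z < r y) (x :: s).
  by apply: (sub_in_cycle _ nb cyc) => y z by_ _ /hr; apply.
move/order_path_min => /(_ (fun _ _ _ h1 h2 => ltn_trans h2 h1)).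
by rewrite all_rcons ltnn.
Qed.

(* A cyclic formula without a root, the condition on cycles being witnessed by
   a rank that decreases along the edges leaving a vertex not labelled [LBox]. *)
Record sys := Sys {
  state :> finType;
  next : state -> seq state;
  slab : state -> label;
  size_next : forall x, size (next x) = arity (slab x);
  srank : state -> nat;
  srank_lt : forall x y, y \in next x -> slab x != LBox -> srank y < srank x
}.

(** Canonical, so that unification finds the system of a state that is given as a vertex of a
    formula. *)
Definition sys_of_formula (G : formula) : sys :=
  Sys (@size_succ G) (@rank_lt G).
Coercion sys_of_formula : formula >-> sys.
Canonical sys_of_formula.

(** * Bisimilarity of states *)

Definition sim (S T : sys) (x : S) (y : T) : Prop :=
  exists2 R : S -> T -> Prop,
    forall a b, R a b -> slab a = slab b /\
      forall i, i < arity (slab a) -> R (nth a (next a) i) (nth b (next b) i)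
    & R x y.

Lemma sim_refl (S : sys) (x : S) : sim x x.
Proof. by exists eq => // a b ->. Qed.

Lemma sim_sym (S T : sys) (x : S) (y : T) : sim x y -> sim y x.
Proof.
case=> R bR Rxy; exists (fun b a => R a b) => // b a /bR[e h].
by rewrite -e; split.
Qed.

Lemma sim_trans (S T U : sys) (x : S) (y : T) (z : U) :
  sim x y -> sim y z -> sim x z.
Proof.
case=> R bR Rxy [Q bQ Qyz]; exists (fun a c => exists2 b, R a b & Q b c).
  move=> a c [b /bR[e h] /bQ[e' h']]; rewrite e; split=> // i li.
  by exists (nth b (next b) i); [apply: h; rewrite e | apply: h'].
by exists y.
Qed.

Lemma sim_unfold (S T : sys) (x : S) (y : T) : sim x y ->
  slab x = slab y /\
  forall i, i < arity (slab x) -> sim (nth x (next x) i) (nth y (next y) i).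
Proof.
by case=> R bR /[dup] Rxy /bR[e h]; split=> // i /h; exists R.
Qed.

(** Adding the single pair [(x, y)] to [sim] yields a bisimulation. *)
Lemma sim_fold (S T : sys) (x : S) (y : T) : slab x = slab y ->
  (forall i, i < arity (slab x) -> sim (nth x (next x) i) (nth y (next y) i)) ->
  sim x y.
Proof.
move=> e h; exists (fun a b => (a = x /\ b = y) \/ sim a b); last by left.
move=> a b [[-> ->]|/sim_unfold[ea ha]]; split=> // i; last by right; apply: ha.
by right; apply: h.
Qed.

(** By conversion [bisimilar] is [sim] between the roots, so facts about states apply to formulas
    directly. *)
Lemma bisimilar_refl (A : formula) : bisimilar A A.
Proof. exact: (@sim_refl A). Qed.

Lemma bisimilar_sym (A B : formula) : bisimilar A B -> bisimilar B A.
Proof. exact: (@sim_sym A B). Qed.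

Lemma bisimilar_trans (A B C : formula) :
  bisimilar A B -> bisimilar B C -> bisimilar A C.
Proof. exact: (@sim_trans A B C). Qed.

(** * The subformula generated by a state *)

Section Point.
Variables (S : sys) (x : S).

Let e : rel S := fun y z => z \in next y.

Definition point_vertex := {y : S | connect e x y}.

Definition point_root : point_vertex := exist _ x (connect0 e x).

(** Successors of reachable states are reachable, so the default [point_root] is never taken. *)
Definition point_succ (v : point_vertex) : seq point_vertex :=
  map (insubd point_root) (next (val v)).

Lemma val_point_succ v : map val (point_succ v) = next (val v).
Proof.
rewrite -map_comp; apply: map_id_in => z zv /=; rewrite val_insubd.
by rewrite ifT //; apply: connect_trans (valP v) _; apply: connect1.
Qed.

Definition point_lab (v : point_vertex) : label := slab (val v).

Lemma point_size v : size (point_succ v) = arity (point_lab v).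
Proof. by rewrite size_map size_next. Qed.

Lemma point_reach v : connect (fun y z => z \in point_succ y) point_root v.
Proof.
have /connectP[s ps es] := valP v.
elim/last_ind: s v ps es => [|s y IH] v.
  by move=> _ /= ev; rewrite (_ : v = point_root) ?connect0 //; exact: val_inj.
rewrite rcons_path last_rcons => /andP[ps ys] ev.
have cu : connect e x (last x s) by apply/connectP; exists s.
pose u : point_vertex := exist (connect e x) _ cu.
apply: (@connect_trans _ _ u); first exact: IH.
by apply: connect1; rewrite -(mem_map val_inj) val_point_succ ev.
Qed.

Definition point_graph : graph := Graph point_size point_reach.

Lemma point_boxed : cycles_boxed point_graph.
Proof.
apply: (@boxed_of_rank point_graph (fun v => srank (val v))) => v w vw.
by apply: srank_lt; rewrite -val_point_succ map_f.
Qed.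

Definition point : formula := Formula point_boxed.

Lemma point_sim : sim (root point : point) x.
Proof.
exists (fun (v : point) y => val v = y) => // v y <-; split=> // i li.
by rewrite -val_point_succ (nth_map v) // size_succ.
Qed.

End Point.

Lemma bisimilar_point (S T : sys) (x : S) (y : T) :
  sim x y -> bisimilar (point x) (point y).
Proof.
move=> xy; apply: (sim_trans (point_sim x)).
exact: (sim_trans xy (sim_sym (point_sim y))).
Qed.

Lemma bisimilar_point_root (S : sys) (x : S) (A : formula) :
  sim x (root A : A) -> bisimilar (point x) A.
Proof. exact: (sim_trans (point_sim x)). Qed.

Lemma unary_sim l (hl : arity l = 1) (A : formula) (x : A) :
  sim (Some x : unary hl A) x.
Proof.
exists (fun (v : unary hl A) y => v = Some y) => // _ y ->; split=> // i li /=.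
by rewrite (nth_map y) ?size_succ.
Qed.

Lemma binary_siml l (hl : arity l = 2) (A B : formula) (x : A) :
  sim (Some (inl x) : binary hl A B) x.
Proof.
exists (fun (v : binary hl A B) y => v = Some (inl y)) => // _ y ->.
by split=> // i li /=; rewrite (nth_map y) ?size_succ.
Qed.

Lemma binary_simr l (hl : arity l = 2) (A B : formula) (x : B) :
  sim (Some (inr x) : binary hl A B) x.
Proof.
exists (fun (v : binary hl A B) y => v = Some (inr y)) => // _ y ->.
by split=> // i li /=; rewrite (nth_map y) ?size_succ.
Qed.

Lemma sim_unary l (hl : arity l = 1) (S : sys) (x y : S) (A : formula) :
  slab x = l -> next x = [:: y] -> sim y (root A : A) ->
  sim x (root (unary hl A) : unary hl A).
Proof.
move=> lx nx yA; apply: sim_fold; rewrite lx // hl nx => -[|i] //= _.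
exact: (sim_trans yA (sim_sym (unary_sim _ _))).
Qed.

Lemma sim_binary l (hl : arity l = 2) (S : sys) (x y z : S) (A B : formula) :
  slab x = l -> next x = [:: y; z] -> sim y (root A : A) ->
  sim z (root B : B) -> sim x (root (binary hl A B) : binary hl A B).
Proof.
move=> lx nx yA zB; apply: sim_fold; rewrite lx // hl nx => -[|[|i]] //= _.
  exact: (sim_trans yA (sim_sym (binary_siml _ _ _))).
exact: (sim_trans zB (sim_sym (binary_simr _ _ _))).
Qed.

Lemma bisimilar_unary l (hl : arity l = 1) (A B : formula) :
  bisimilar A B -> bisimilar (unary hl A) (unary hl B).
Proof.
move=> AB; apply: (@sim_unary l hl (unary hl A) _ (Some (root A))) => //.
exact: (sim_trans (unary_sim _ _) AB).
Qed.

Lemma bisimilar_binary l (hl : arity l = 2) (A B C D : formula) :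
  bisimilar A B -> bisimilar C D ->
  bisimilar (binary hl A C) (binary hl B D).
Proof.
move=> AB CD.
apply: (@sim_binary l hl (binary hl A C) _ (Some (inl (root A)))
                                         (Some (inr (root C)))) => //.
  exact: (sim_trans (binary_siml _ _ _) AB).
exact: (sim_trans (binary_simr _ _ _) CD).
Qed.

Lemma point_unary l (hl : arity l = 1) (S : sys) (x y : S) :
  slab x = l -> next x = [:: y] -> bisimilar (point x) (unary hl (point y)).
Proof.
move=> lx nx; apply: bisimilar_point_root.
exact: (sim_unary _ lx nx (sim_sym (point_sim y))).
Qed.

Lemma point_binary l (hl : arity l = 2) (S : sys) (x y z : S) :
  slab x = l -> next x = [:: y; z] ->
  bisimilar (point x) (binary hl (point y) (point z)).
Proof.
move=> lx nx; apply: bisimilar_point_root.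
exact: (sim_binary _ lx nx (sim_sym (point_sim y)) (sim_sym (point_sim z))).
Qed.

(** * Substitution of a formula for a variable *)

Section Substitution.
Variables (p : nat) (H : formula).

(* The states labelled [LVar p] are kept and turned into copies of the root of
   [H], so that no edge has to be redirected. *)
Section SubSys.
Variable S : sys.

Definition sub_next (v : S + H) : seq (S + H) :=
  match v with
  | inl x => if slab x == LVar p then map inr (succ (root H))
             else map inl (next x)
  | inr y => map inr (succ y)
  end.

Definition sub_lab (v : S + H) : label :=
  match v with
  | inl x => if slab x == LVar p then lab (root H) else slab x
  | inr y => lab y
  end.

Lemma sub_size v : size (sub_next v) = arity (sub_lab v).
Proof.
case: v => [x|y] /=; last by rewrite size_map size_succ.
by case: ifP => _; rewrite size_map ?size_succ ?size_next.
Qed.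

(** The offset [rank (root H)] makes the rank drop when a state labelled [LVar p], now a copy of the
    root of [H], steps into [H]. *)
Definition sub_rank (v : S + H) : nat :=
  match v with inl x => srank x + rank (root H) | inr y => rank y end.

Lemma sub_rank_lt v w :
  w \in sub_next v -> sub_lab v != LBox -> sub_rank w < sub_rank v.
Proof.
case: v => [x|y] /=; last by case/mapP=> z zy -> /rank_lt; apply.
case: ifP => _ /mapP[z zx ->] bx /=; last by rewrite ltn_add2r srank_lt.
by rewrite ltn_addl // rank_lt.
Qed.

Definition sub_sys : sys := Sys sub_size sub_rank_lt.

Lemma sub_inr (y : H) : sim (inr y : sub_sys) y.
Proof.
exists (fun (v : sub_sys) z => v = inr z) => // _ z ->; split=> // i li /=.
by rewrite (nth_map z) ?size_succ.
Qed.

Lemma sub_var (x : S) : slab x = LVar p -> sim (inl x : sub_sys) (root H : H).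
Proof.
move=> lx; apply: sim_fold => /=; rewrite lx eqxx // => i li.
by rewrite (nth_map (root H)) ?size_succ //; exact: sub_inr.
Qed.

End SubSys.

(** Pairs labelled [LVar p] both behave like the root of [H]; all other pairs keep their labels and
    pass to pairs of similar successors. *)
Lemma sub_sim (S T : sys) (x : S) (y : T) :
  sim x y -> sim (inl x : sub_sys S) (inl y : sub_sys T).
Proof.
move=> xy; exists (fun (v : sub_sys S) (w : sub_sys T) => sim v w \/
    exists a b, [/\ v = inl a, w = inl b & sim a b]); last by right; exists x, y.
move=> v w [/sim_unfold[e h]|[a [b [-> -> ab]]]].
  by split=> // i li; left; apply: h.
have [ap|ap] := eqVneq (slab a) (LVar p).
  have /sim_unfold[e h] : sim (inl a : sub_sys S) (inl b : sub_sys T).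
    apply: sim_trans (sub_var ap) (sim_sym (sub_var _)).
    by rewrite -ap; case: (sim_unfold ab).
  by split=> // i li; left; apply: h.
have [e h] := sim_unfold ab.
rewrite /= -e (negPf ap); split=> // i li; right.
exists (nth a (next a) i), (nth b (next b) i).
by rewrite !(nth_map a, nth_map b) ?size_next -?e //; split=> //; exact: h.
Qed.

Definition subst (A : formula) : formula := point (inl (root A) : sub_sys A).

Lemma subst_bisimilar (A B : formula) :
  bisimilar A B -> bisimilar (subst A) (subst B).
Proof. by move=> AB; apply/bisimilar_point/sub_sim. Qed.

Lemma subst_var : bisimilar (subst (fVar p)) H.
Proof. by apply: bisimilar_point_root; exact: sub_var. Qed.

Lemma subst_leaf l (hl : arity l = 0) :
  l != LVar p -> bisimilar (subst (leaf hl)) (leaf hl).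
Proof.
move=> lp; apply: bisimilar_point_root; apply: sim_fold => /=;
by rewrite (negPf lp) // hl.
Qed.

Lemma subst_unary l (hl : arity l = 1) (A : formula) :
  bisimilar (subst (unary hl A)) (unary hl (subst A)).
Proof.
have lp : l != LVar p by apply: contra_eqN hl => /eqP->.
apply: bisimilar_point_root.
apply: (@sim_unary l hl _ _ (inl (Some (root A)) : sub_sys (unary hl A)));
  rewrite /= ?(negPf lp) //.
exact: (sim_trans (sub_sim (unary_sim _ _)) (sim_sym (point_sim _))).
Qed.

Lemma subst_binary l (hl : arity l = 2) (A B : formula) :
  bisimilar (subst (binary hl A B)) (binary hl (subst A) (subst B)).
Proof.
have lp : l != LVar p by apply: contra_eqN hl => /eqP->.
apply: bisimilar_point_root.
apply: (@sim_binary l hl _ _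
          (inl (Some (inl (root A))) : sub_sys (binary hl A B))
          (inl (Some (inr (root B))))); rewrite /= ?(negPf lp) //.
  exact: (sim_trans (sub_sim (binary_siml _ _ _)) (sim_sym (point_sim _))).
exact: (sim_trans (sub_sim (binary_simr _ _ _)) (sim_sym (point_sim _))).
Qed.

Lemma subst_fresh (A : formula) : ~ occurs p A -> bisimilar (subst A) A.
Proof.
move=> nA; apply: bisimilar_point_root.
exists (fun (v : sub_sys A) (y : A) => v = inl y) => // _ y -> /=.
have [yp|yp] := eqVneq (lab y) (LVar p); first by case: nA; exists y.
by split=> // i li; rewrite (nth_map y) ?size_succ.
Qed.

Lemma subst_psubst (f : nat -> formula) (t : pform) :
  bisimilar (subst (psubst f t)) (psubst (fun i => subst (f i)) t).
Proof.
elim: t => [||i|t IH|t IHt u IHu|t IHt u IHu|t IHt u IHu].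
- exact: subst_leaf.
- exact: subst_leaf.
- exact: bisimilar_refl (subst (f i)).
- exact: bisimilar_trans (subst_unary _ _) (bisimilar_unary _ IH).
- exact: bisimilar_trans (subst_binary _ _ _) (bisimilar_binary _ IHt IHu).
- exact: bisimilar_trans (subst_binary _ _ _) (bisimilar_binary _ IHt IHu).
- exact: bisimilar_trans (subst_binary _ _ _) (bisimilar_binary _ IHt IHu).
Qed.

End Substitution.

(** * Fixed points: unfolding and uniqueness *)

Lemma redirect_var (p : nat) (A : formula) (hA : modalised p A) (v : A) :
  lab v = LVar p -> redirect hA v = root (digamma hA).
Proof. by move=> vp; apply: val_inj; rewrite val_insubd vp eqxx. Qed.

Lemma val_redirect (p : nat) (A : formula) (hA : modalised p A) (v : A) :
  lab v != LVar p -> val (redirect hA v) = v.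
Proof. by move=> vp; rewrite val_insubd vp. Qed.

(** Both maps preserve labels and successors away from [LVar p]; at a vertex labelled [LVar p] both
    sides behave like the root of the fixed point. *)
Lemma redirect_sub (p : nat) (A : formula) (hA : modalised p A) (v : A) :
  sim (redirect hA v : digamma hA) (inl v : sub_sys p (digamma hA) A).
Proof.
set D := digamma hA.
exists (fun (d : D) (w : sub_sys p D A) => sim d w \/
    exists2 u : A, d = redirect hA u & w = inl u); last by right; exists v.
move=> d w [/sim_unfold[e h]|[u -> ->]].
  by split=> // i li; left; apply: h.
have [up|up] := eqVneq (lab u) (LVar p).
  rewrite redirect_var //.
  have /sim_unfold[e h] := sim_sym (@sub_var p D A u up).
  by split=> // i li; left; apply: h.
have vu := val_redirect hA up.
rewrite /= /dlab vu (negPf up); split=> // i li; right.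
exists (nth u (succ u) i).
  by rewrite /dsucc vu (nth_map u) ?size_succ.
by rewrite (nth_map u) ?size_succ.
Qed.

Lemma redirect_root (p : nat) (A : formula) (hA : modalised p A) :
  redirect hA (root A) = root (digamma hA).
Proof. exact: (redirectK hA (droot hA)). Qed.

Lemma digamma_subst (p : nat) (A : formula) (hA : modalised p A) :
  bisimilar (digamma hA) (subst p (digamma hA) A).
Proof.
have := redirect_sub hA (root A); rewrite redirect_root => h.
exact: (sim_trans h (sim_sym (point_sim _))).
Qed.

Lemma bullet_unfold (p : nat) (A : formula) : ~ occurs p A ->
  bisimilar (fBoxBullet p A) (fBox (fAnd A (fBoxBullet p A))).
Proof.
move=> pA; apply: bisimilar_trans (digamma_subst _) _.
apply: bisimilar_trans (subst_unary _ _ _ _) (bisimilar_unary _ _).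
apply: bisimilar_trans (subst_binary _ _ _ _ _) (bisimilar_binary _ _ _).
  exact: subst_fresh.
exact: subst_var.
Qed.

Lemma box_and_unique (A X Y : formula) :
  bisimilar X (fBox (fAnd A X)) -> bisimilar Y (fBox (fAnd A Y)) ->
  bisimilar X Y.
Proof.
move=> hX hY.
have {}hX : sim (root X : X) (root (fBox (fAnd A X))) := hX.
have {}hY : sim (root Y : Y) (root (fBox (fAnd A Y))) := hY.
pose AX := root (fAnd A X); pose AY := root (fAnd A Y).
(* Unfolding takes a pair of roots to a pair of conjunctions, and that pair to two copies of
   [root A], which are similar, and to a pair of roots again. *)
exists (fun (x : X) (y : Y) => [\/ sim x y, sim x (root X) /\ sim y (root Y)
  | sim x AX /\ sim y AY]); last by constructor 2; split; apply: sim_refl.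
move=> x y [/sim_unfold[e h]|[hx hy]|[hx hy]].
- by split=> // i li; constructor 1; apply: h.
- have [/= ex hx1] := sim_unfold (sim_trans hx hX).
  have [/= ey hy1] := sim_unfold (sim_trans hy hY).
  rewrite ex ey in hx1 hy1 *; split=> // -[|//] _; constructor 3; split.
    exact: (sim_trans (hx1 0 isT) (unary_sim _ _)).
  exact: (sim_trans (hy1 0 isT) (unary_sim _ _)).
- have [/= ex hx1] := sim_unfold hx; have [/= ey hy1] := sim_unfold hy.
  rewrite ex ey in hx1 hy1 *; split=> // -[|[|//]] _.
    constructor 1; apply: (sim_trans (hx1 0 isT)).
    apply: (sim_trans (binary_siml _ _ _)); apply: sim_sym.
    exact: (sim_trans (hy1 0 isT) (binary_siml _ _ _)).
  constructor 2; split.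
    exact: (sim_trans (hx1 1 isT) (binary_simr _ _ _)).
  exact: (sim_trans (hy1 1 isT) (binary_simr _ _ _)).
Qed.

(** * Propositional and modal reasoning in any of the logics *)

Section Derivations.
Variables (Ax : formula -> Prop) (Ru : formula -> formula -> Prop).

Local Notation "|- A" := (derivable Ax Ru A) (at level 99).

(** Propositional consequence with curried premises: once the formulas are reified by [fs], only a
    truth table is left to check. *)
Lemma conseq (fs : seq formula) (hs : seq pform) (t : pform) :
  (forall e, all (peval e) hs ==> peval e t) ->
  foldr (fun h P => derivable Ax Ru (psubst (nth fTop fs) h) -> P)
        (derivable Ax Ru (psubst (nth fTop fs) t)) hs.
Proof.
elim: hs t => [|h hs IH] t ht; first exact: der_taut.
move=> dh; have := IH (PImp h t); set P := foldr _ _ _; set Q := foldr _ _ _.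
(* Modus ponens with the premise [h], carried out under the remaining premises. *)
have PQ : P -> Q.
  rewrite {}/P {}/Q; elim: hs {IH ht} => [|k hs IH] /=.
    by move/der_mp; apply.
  by move=> h1 /h1.
move=> hP; apply/PQ/hP => e; have /= := ht e.
by case: (peval e h); case: (all _ _); case: (peval e t).
Qed.

Local Notation x0 := (PVar 0).
Local Notation x1 := (PVar 1).
Local Notation x2 := (PVar 2).
Local Notation x3 := (PVar 3).
Local Notation x4 := (PVar 4).
Local Notation PIff a b := (PAnd (PImp a b) (PImp b a)).

Ltac truth_table :=
  let e := fresh in move=> e /=; do ![by [] | case: (e _)].

Lemma imp_trans A B C : (|- fImp A B) -> (|- fImp B C) -> |- fImp A C.
Proof.
apply: (@conseq [:: A; B; C] [:: PImp x0 x1; PImp x1 x2] (PImp x0 x2)).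
truth_table.
Qed.

Lemma imp_weaken A B : (|- B) -> |- fImp A B.
Proof. by apply: (@conseq [:: A; B] [:: x1] (PImp x0 x1)); truth_table. Qed.

Lemma imp_and X A B : (|- fImp X A) -> (|- fImp X B) -> |- fImp X (fAnd A B).
Proof.
apply: (@conseq [:: X; A; B] [:: PImp x0 x1; PImp x0 x2]
                (PImp x0 (PAnd x1 x2))).
truth_table.
Qed.

Lemma imp_mp X A B : (|- fImp X (fImp A B)) -> (|- fImp X A) -> |- fImp X B.
Proof.
apply: (@conseq [:: X; A; B] [:: PImp x0 (PImp x1 x2); PImp x0 x1]
                (PImp x0 x2)).
truth_table.
Qed.

Lemma and_imp_l A B : |- fImp (fAnd A B) A.
Proof. by apply: (@conseq [:: A; B] [::] (PImp (PAnd x0 x1) x0)); truth_table. Qed.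

Lemma and_imp_r A B : |- fImp (fAnd A B) B.
Proof. by apply: (@conseq [:: A; B] [::] (PImp (PAnd x0 x1) x1)); truth_table. Qed.

Lemma iff_mp A B : (|- fIff A B) -> (|- A) -> |- B.
Proof. by apply: (@conseq [:: A; B] [:: PIff x0 x1; x0] x1); truth_table. Qed.

Lemma bisimilar_mp (A B : formula) : bisimilar A B -> (|- A) -> |- B.
Proof. by move=> AB; apply/iff_mp/der_bisim. Qed.

Lemma box_mono A B : (|- fImp A B) -> |- fImp (fBox A) (fBox B).
Proof. by move/der_nec; apply/der_mp/der_K. Qed.

Lemma imp_iff_box X A B :
  (|- fImp X (fBox (fIff A B))) -> |- fImp X (fIff (fBox A) (fBox B)).
Proof.
move=> h; apply: imp_and.
  apply: imp_trans (der_K _ _ _ _); apply: imp_trans h _.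
  exact/box_mono/and_imp_l.
apply: imp_trans (der_K _ _ _ _); apply: imp_trans h _.
exact/box_mono/and_imp_r.
Qed.

Lemma imp_iff_neg X A B :
  (|- fImp X (fIff A B)) -> |- fImp X (fIff (fNeg A) (fNeg B)).
Proof.
apply: (@conseq [:: X; A; B] [:: PImp x0 (PIff x1 x2)]
                (PImp x0 (PIff (PNeg x1) (PNeg x2)))).
truth_table.
Qed.

Lemma imp_iff_binary l (hl : arity l = 2) X A A' B B' :
  (|- fImp X (fIff A A')) -> (|- fImp X (fIff B B')) ->
  |- fImp X (fIff (binary hl A B) (binary hl A' B')).
Proof.
have conn (op : pform -> pform -> pform) :
    (forall e, all (peval e) [:: PImp x0 (PIff x1 x2); PImp x0 (PIff x3 x4)]
      ==> peval e (PImp x0 (PIff (op x1 x3) (op x2 x4)))) -> _ :=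
  @conseq [:: X; A; A'; B; B'] _ (PImp x0 (PIff (op x1 x3) (op x2 x4))).
(* Only the three binary connectives survive; replacing [hl] by [erefl] turns [binary hl] into
   [fAnd], [fOr] or [fImp]. *)
case: l hl => // hl; rewrite (eq_irrelevance hl erefl).
- by apply: (conn PAnd); truth_table.
- by apply: (conn POr); truth_table.
- by apply: (conn PImp); truth_table.
Qed.

Lemma iff_trans_imp A B C : (|- fIff B C) -> |- fImp (fIff A B) (fIff A C).
Proof.
apply: (@conseq [:: A; B; C] [:: PIff x1 x2] (PImp (PIff x0 x1) (PIff x0 x2))).
truth_table.
Qed.

(** For [B] a variable [p], the two sides are the formulas whose fixed points are [fBoxBullet p A]
    and the Henkin axiom. *)
Lemma bullet_iff_box A B : (|- A) -> |- fIff (fBox (fAnd A B)) (fBox B).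
Proof.
move=> hA.
have AB : |- fImp B (fAnd A B).
  apply: imp_and (imp_weaken _ hA) _.
  by apply: (@conseq [:: B] [::] (PImp x0 x0)); truth_table.
move: (box_mono (and_imp_r A B)) (box_mono AB).
apply: (@conseq [:: fBox (fAnd A B); fBox B] [:: PImp x0 x1; PImp x1 x0]
                (PIff x0 x1)).
truth_table.
Qed.

Definition conj (s : seq formula) : formula := foldr fAnd fTop s.

Lemma conj_elim (T : eqType) (h : T -> formula) (s : seq T) x :
  x \in s -> |- fImp (conj (map h s)) (h x).
Proof.
elim: s => //= y s IH; rewrite inE => /predU1P[->|/IH]; first exact: and_imp_l.
exact/imp_trans/and_imp_r.
Qed.

Lemma conj_intro (T : Type) (X : formula) (h : T -> formula) (s : seq T) :
  (forall x, |- fImp X (h x)) -> |- fImp X (conj (map h s)).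
Proof.
move=> hX; elim: s => [|x s IH] /=; last exact: imp_and.
by apply: imp_weaken; apply: (@conseq [::] [::] PTop).
Qed.

End Derivations.

(** * Closure of CHL under substitution *)

Lemma CHL_subst (A : formula) (p : nat) (H : formula) :
  CHL A -> CHL (subst p H A).
Proof.
(* Substitution commutes with the connectives only up to bisimilarity, so the cases for axioms and
   rules are transported along [bisimilar_mp]. *)
have sub2 := @subst_binary p H; have sub1 := @subst_unary p H.
elim=> {A} [t f tt|A B|A B AB|A B _ hAB _ hA|A _ hA|A []|A B [{}A] _ hA].
- exact: bisimilar_mp (bisimilar_sym (subst_psubst p H f t)) (der_taut _ _ _ tt).
- apply: bisimilar_mp (bisimilar_sym _) (der_K _ _ (subst p H A) (subst p H B)).
  apply: bisimilar_trans (sub2 _ _ _ _) (bisimilar_binary _ _ _).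
    apply: bisimilar_trans (sub1 _ _ _) (bisimilar_unary _ _); exact: sub2.
  apply: bisimilar_trans (sub2 _ _ _ _) (bisimilar_binary _ _ _); exact: sub1.
- apply: bisimilar_mp (bisimilar_sym _)
    (der_bisim _ _ (subst_bisimilar p H AB)).
  by apply: bisimilar_trans (sub2 _ _ _ _) (bisimilar_binary _ _ _); exact: sub2.
- exact: der_mp (bisimilar_mp (sub2 _ _ _ _) hAB) hA.
- exact: bisimilar_mp (bisimilar_sym (sub1 _ _ _)) (der_nec hA).
- apply: der_rule (Loeb _) (bisimilar_mp _ hA).
  apply: bisimilar_trans (sub2 _ _ _ _) (bisimilar_binary _ _ _).
    exact: sub1.
  exact: bisimilar_refl.
Qed.

(** * Admissibility of IPE in CHL *)

Section Unravelling.
Variables (p : nat) (A : formula) (S T : sys) (f : A -> S) (g : A -> T).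
(* Instantiated with [redirect] into the fixed point of [A] and with [inl] into
   the substitution in [A] of the fixed point of [B]. *)
Hypothesis f_hom : forall v, lab v != LVar p ->
  slab (f v) = lab v /\ next (f v) = map f (succ v).
Hypothesis g_hom : forall v, lab v != LVar p ->
  slab (g v) = lab v /\ next (g v) = map g (succ v).

Let W v := fIff (point (f v)) (point (g v)).
Let all_W := conj (map W (enum A)).

(** Equivalence is a congruence. At a box the successors need to be equivalent only under a box,
    which [fBox all_W] provides; elsewhere their equivalence is assumed. *)
Lemma equiv_step (X : formula) (v : A) : lab v != LVar p ->
  CHL (fImp X (fBox all_W)) ->
  (~~ is_box v -> forall w, edge v w -> CHL (fImp X (W w))) ->
  CHL (fImp X (W v)).
Proof.
move=> vp hX hW; have [fl fn] := f_hom vp; have [gl gn] := g_hom vp.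
have sv := size_succ v.
have iff_bisimilar (B B' C C' : formula) : bisimilar B B' -> bisimilar C C' ->
    CHL (fImp X (fIff B' C')) -> CHL (fImp X (fIff B C)).
  move=> BB CC; apply: bisimilar_mp; apply: bisimilar_sym.
  apply: bisimilar_binary (bisimilar_refl _) (bisimilar_binary _ _ _);
  by apply: bisimilar_binary.
move: hW; rewrite /edge; case es: (succ v) sv fn gn => [|w [|u [|]]] sv fn gn hW.
- apply: imp_weaken; apply: der_bisim; apply: bisimilar_point.
  by apply: sim_fold; rewrite fl ?gl // -sv.
- have l1 : arity (lab v) = 1 by rewrite -sv.
  apply: iff_bisimilar (point_unary l1 fl fn) (point_unary l1 gl gn) _.
  have [bv|bv] := boolP (is_box v).
    move: l1; rewrite (eqP bv) => l1; rewrite (eq_irrelevance l1 erefl).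
    apply/imp_iff_box/(imp_trans hX)/box_mono.
    by apply: (@conj_elim _ _ _ W); rewrite mem_enum.
  have {}hW := hW bv w (mem_head _ _).
  move: bv; rewrite /is_box; case: (lab v) l1 => //= l1 _.
  by rewrite (eq_irrelevance l1 erefl); exact: imp_iff_neg.
- have l2 : arity (lab v) = 2 by rewrite -sv.
  apply: iff_bisimilar (point_binary l2 fl fn) (point_binary l2 gl gn) _.
  have bv : ~~ is_box v by apply: contra_eqN l2 => /eqP->.
  by apply: imp_iff_binary; apply: hW => //; rewrite !inE eqxx ?orbT.
- by case: (lab v) sv.
Qed.

(** Induction on [rank], which drops along edges leaving a vertex that is no box. The disjunction
    covers both uses: either a box precedes [LVar p], or the equivalence is already known there. *)
Lemma equiv_ind (X : formula) (v : A) : CHL (fImp X (fBox all_W)) ->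
  (forall s, path (@edge A) v s -> lab (last v s) = LVar p ->
     has (@is_box A) (v :: s) \/ CHL (fImp X (W (last v s)))) ->
  CHL (fImp X (W v)).
Proof.
move=> hX; have [n] := ubnP (rank v); elim: n v => // n IH v /ltnSE rv hv.
have [vp|vp] := eqVneq (lab v) (LVar p).
  (* The empty path ends at [v], which is no box, so the second alternative holds. *)
  by have [|] := hv [::] isT vp; rewrite //= /is_box vp.
apply: equiv_step => // bv w vw; apply: IH.
  exact: leq_trans (rank_lt vw bv) rv.
move=> s ws ls; have := hv (w :: s).
by rewrite /= vw (negPf bv); apply.
Qed.

Lemma equiv_unravelling : modalised p A ->
  (forall v, lab v = LVar p -> CHL (fImp (W (root A)) (W v))) ->
  CHL (W (root A)).
Proof.
move=> hA hp.
have self : CHL (fImp (fBox all_W) (fBox all_W)).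
  exact: (@der_taut _ _ (PImp (PVar 0) (PVar 0)) (fun=> _) (fun e => implybb _)).
have h_root : CHL (fImp (fBox all_W) (W (root A))).
  by apply: equiv_ind => // s ps ls; left; exact: hA.
have h_all : CHL all_W.
  apply: der_rule (Loeb _) _; apply: conj_intro => v.
  apply: equiv_ind => // s _ ls.
  by right; exact: imp_trans h_root (hp _ ls).
by apply: der_mp h_all; apply: (@conj_elim _ _ _ W); rewrite mem_enum.
Qed.

End Unravelling.

Lemma CHL_ipe (p : nat) (A B : formula)
    (hA : modalised p A) (hB : modalised p B) :
  CHL (fIff A B) -> CHL (fIff (digamma hA) (digamma hB)).
Proof.
move=> AB; set a := digamma hA; set b := digamma hB.
have sAb : CHL (fIff (subst p b A) b).
  have sAB : CHL (fIff (subst p b A) (subst p b B)).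
    apply: bisimilar_mp (CHL_subst p b AB).
    apply: bisimilar_trans (subst_binary _ _ _ _ _) (bisimilar_binary _ _ _);
    exact: subst_binary.
  apply: bisimilar_mp sAB; have := bisimilar_sym (digamma_subst hB) => h.
  by apply: bisimilar_binary; apply: bisimilar_binary => //; exact: bisimilar_refl.
have a_root : bisimilar (point (redirect hA (root A) : a)) a.
  rewrite redirect_root; apply: bisimilar_point_root.
  exact: (sim_refl (root a : a)).
(* This is [W] at the root of [A], as [subst p b A] is by definition the point at [inl (root A)]. *)
suff h : CHL (fIff (point (redirect hA (root A) : a)) (subst p b A)).
  apply: bisimilar_mp (der_mp (iff_trans_imp _ sAb) h).
  by apply: bisimilar_binary; apply: bisimilar_binary => //; exact: bisimilar_refl.
apply: (@equiv_unravelling p A a (sub_sys p b A) (redirect hA) inl) => //.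
- move=> v vp; have vv := val_redirect hA vp.
  by rewrite /= /dlab /dsucc vv.
- by move=> v vp; rewrite /= (negPf vp).
(* At [v] the left side is that of the root and the right side is bisimilar to [b], so [sAb] leads
   from [W] at the root to [W v]. *)
move=> v vp; rewrite (redirect_var hA vp) -redirect_root.
have vb : bisimilar b (point (inl v : sub_sys p b A)).
  by apply/bisimilar_sym/bisimilar_point_root; exact: sub_var.
apply: bisimilar_mp (iff_trans_imp _ sAb).
apply: bisimilar_binary (bisimilar_refl _) (bisimilar_binary _ _ _);
  by apply: bisimilar_binary => //; exact: bisimilar_refl.
Qed.

(** * The three inclusions *)

Lemma CHL0_sub_CHL (A : formula) : CHL0 A -> CHL A.
Proof.
elim=> {A} [t f|A B|A B|A B _ hAB _ hA|A _ hA|A [p]|A B [p C D hC hD] _ hA].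
- exact: der_taut.
- exact: der_K.
- exact: der_bisim.
- exact: der_mp hAB hA.
- exact: der_nec.
- apply: der_rule (Loeb _) _; set D := digamma _.
  (* The premise of Löb's rule is the right half of the equivalence of [D] and [fBox D]. *)
  apply: der_mp (and_imp_r _ _ _ _) (der_bisim _ _ _).
  apply: bisimilar_trans (digamma_subst _) _.
  apply: bisimilar_trans (subst_unary _ _ _ _) (bisimilar_unary _ _).
  exact: subst_var.
- exact: CHL_ipe.
Qed.

Lemma CHL1_sub_CHL0 (A : formula) : CHL1 A -> CHL0 A.
Proof.
elim=> {A} [t f|A B|A B|A B _ hAB _ hA|A _ hA|A []|A B [p {}A _] _ hA].
- exact: der_taut.
- exact: der_K.
- exact: der_bisim.
- exact: der_mp hAB hA.
- exact: der_nec.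
have := bullet_iff_box (fVar p) hA.
move/(der_rule (IPE (@modalised_box p (fAnd A (fVar p)))
                    (@modalised_box p (fVar p)))) => h.
apply: der_mp (der_ax _ (Henkin_axiom p)).
exact: der_mp (and_imp_r _ _ _ _) h.
Qed.

Lemma fresh_var (A : formula) : exists p, ~ occurs p A.
Proof.
pose n (v : A) := if lab v is LVar i then i else 0.
exists (\max_(v : A) n v).+1 => -[v lv].
by have := leq_bigmax v (F := n); rewrite {1}/n lv ltnn.
Qed.

Lemma CHL1_loeb (A : formula) : CHL1 (fImp (fBox A) A) -> CHL1 A.
Proof.
move=> hA; have [p pA] := fresh_var A.
pose s := digamma (@modalised_box p (fAnd (fImp (fVar p) A) (fVar p))).
have s_unfold : bisimilar s (fBox (fAnd (fImp s A) s)).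
  apply: bisimilar_trans (digamma_subst _) _.
  apply: bisimilar_trans (subst_unary _ _ _ _) (bisimilar_unary _ _).
  apply: bisimilar_trans (subst_binary _ _ _ _ _) (bisimilar_binary _ _ _).
    apply: bisimilar_trans (subst_binary _ _ _ _ _) (bisimilar_binary _ _ _).
      exact: subst_var.
    exact: subst_fresh.
  exact: subst_var.
(* Unfolded, [s] boxes both [s -> A] and [s]; hence it implies [fBox A], and then [A] by [hA]. *)
have sA : CHL1 (fImp s A).
  apply: imp_trans hA; apply: imp_trans (box_mono _); last first.
    apply: (imp_mp (A := s)); first exact: and_imp_l.
    exact: and_imp_r.
  exact: der_mp (and_imp_l _ _ _ _) (der_bisim _ _ s_unfold).
have [q qsA] := fresh_var (fImp s A).
(* It remains to prove [s], which is bisimilar to the formula that the bullet rule derives from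
   [sA]. *)
apply: (der_mp sA); apply: bisimilar_mp (der_rule (Bullet qsA) sA).
exact: box_and_unique (bullet_unfold qsA) s_unfold.
Qed.

Lemma CHL_sub_CHL1 (A : formula) : CHL A -> CHL1 A.
Proof.
elim=> {A} [t f|A B|A B|A B _ hAB _ hA|A _ hA|A []|A B [{}A] _ hA].
- exact: der_taut.
- exact: der_K.
- exact: der_bisim.
- exact: der_mp hAB hA.
- exact: der_nec.
exact: CHL1_loeb.
Qed.

Theorem theorem3p12 :
  forall A : formula, (CHL0 A <-> CHL A) /\ (CHL1 A <-> CHL A).
Proof.
move=> A; split; split.
- exact: CHL0_sub_CHL.
- by move/CHL_sub_CHL1/CHL1_sub_CHL0.
- by move/CHL1_sub_CHL0/CHL0_sub_CHL.
- exact: CHL_sub_CHL1.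
Qed.
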